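(* Let $Q$ be a finite loop. If $C$ is a regular subset of the multiplication table of $Q$, then $P(C_r)$ intersects $A(Q)$. In particular, for every $k\ge 1$, if $Q$ has a $k$-plex (or just a regular row $k$-plex), then $P^k(Q)$ intersects $A(Q)$.
   Context: A loop is a set $Q$ with a binary operation and a neutral element $1$ such that for all $x,z\in Q$ the equations $x\cdot y_1=z$ and $y_2\cdot x=z$ have unique solutions $y_1,y_2\in Q$. Write $L_x(y)=xy$ and $R_x(y)=yx$. The inner mappings of $Q$ are $L(x,y)=L_{yx}^{-1}L_yL_x$, $R(x,y)=R_{xy}^{-1}R_yR_x$ and $T(x)=R_x^{-1}L_x$. A subloop is normal if it is invariant under all inner mappings. The associator subloop $A(Q)$ is the smallest normal subloop of $Q$ such that $Q/A(Q)$ is a group. The multiplication table of $Q$ is the set of triples $\{(x,y,xy):x,y\in Q\}$; in a triple $(x,y,z)$, $x$ is the row, $y$ the column and $z$ the entry. A subset $C$ of the multiplication table is regular (column-entry regular) if every $s\in Q$ appears as a column of triples in $C$ the same number of times as it appears as an entry of triples in $C$. $C_r$ denotes the multiset of elements appearing as rows of the triples in $C$. A $k$-plex is a subset of the multiplication table in which each element of $Q$ appears as a row, as a column, and as an entry precisely $k$ times. A row $k$-plex is a collection of triples in the multiplication table in which each element of $Q$ appears as a row precisely $k$ times; a regular row $k$-plex is a row $k$-plex that is regular. ''$Q$ has'' such an object means that its multiplication table does. For a finite multiset $H$ of elements of $Q$, $P(H)$ is the set of elements of $Q$ that can be written as a product (in some order and with some association/bracketing) whose multiset of factors is exactly $H$;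 the empty product is taken to be $1$. $P^k(Q)$ is the set of elements that can be written as such a product in which every element of $Q$ occurs precisely $k$ times. *)

(* Defs.v *)
From HB Require Import structures.
From mathcomp Require Import all_boot all_fingroup.
From mathcomp Require Import finmap multiset.

Set Implicit Arguments.
Unset Strict Implicit.
Unset Printing Implicit Defensive.

Import GroupScope.
Local Open Scope mset_scope.
Local Open Scope group_scope.

(* The mixin does not extend umagmaType because the library already joins
   BaseUMagma and Countable in FinStarMonoid, so that HB rejects any other
   structure inheriting from both. *)
HB.mixin Record isLoop Q := {
  lone : Q;
  lmul : Q -> Q -> Q;
  lmul1x : forall x : Q, lmul lone x = x;
  lmulx1 : forall x : Q, lmul x lone = x;
  lsolvable : forall x z : Q, exists! y : Q, lmul x y = z;
  rsolvable : forall x z : Q, exists! y : Q, lmul y x = z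
}.

#[short(type="loopType")]
HB.structure Definition Loop := {Q of isLoop Q}.

#[short(type="finLoopType")]
HB.structure Definition FinLoop := {Q of Loop Q & Finite Q}.

Notation "x ** y" := (lmul x y) (at level 40, left associativity).

Section Translations.

Variable Q : finLoopType.
Implicit Types x y : Q.

Lemma loop_mulgI x : injective (fun y => x ** y).
Proof.
move=> y1 y2 /= e; have [y [_ u]] := lsolvable x (x ** y2).
by rewrite -(u y1 e) -(u y2 erefl).
Qed.

Lemma loop_mulIg x : injective (fun y => y ** x).
Proof.
move=> y1 y2 /= e; have [y [_ u]] := rsolvable x (y2 ** x).
by rewrite -(u y1 e) -(u y2 erefl).
Qed.

Definition Ltr x : {perm Q} := perm (@loop_mulgI x).
Definition Rtr x : {perm Q} := perm (@loop_mulIg x).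

(* Permutations are composed from left to right: (s * t) z = t (s z). *)
Definition innerL x y : {perm Q} := Ltr x * Ltr y * (Ltr (y ** x))^-1.
Definition innerR x y : {perm Q} := Rtr x * Rtr y * (Rtr (x ** y))^-1.
Definition innerT x : {perm Q} := Ltr x * (Rtr x)^-1.

End Translations.

Section Normality.

Variable Q : finLoopType.
Implicit Types (N A B : {set Q}).

(* (Ltr x)^-1 z and (Rtr x)^-1 z are the solutions y of x ** y = z and of
   y ** x = z. *)
Definition subloop N : bool :=
  [&& lone \in N,
      [forall x in N, forall y in N, x ** y \in N],
      [forall x in N, forall z in N, (Ltr x)^-1 z \in N]
    & [forall x in N, forall z in N, (Rtr x)^-1 z \in N]].

Definition normal_subloop N : bool :=
  [&& subloop N,
      [forall x, forall y, innerL x y @: N == N],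
      [forall x, forall y, innerR x y @: N == N]
    & [forall x, innerT x @: N == N]].

Definition loop_coset N (x : Q) : {set Q} := Ltr x @: N.

Definition loop_quotient N : {set {set Q}} := [set loop_coset N x | x : Q].

(* On the cosets of a normal N this is (xN)(yN) = (xy)N: see
   loop_coset_mul. *)
Definition set_mul A B : {set Q} := [set a ** b | a in A, b in B].

Definition is_group (T : finType) (G : {set T}) (op : T -> T -> T) (e : T) :
  bool :=
  [&& e \in G,
      [forall a in G, forall b in G, op a b \in G],
      [forall a in G, forall b in G, forall c in G,
         op a (op b c) == op (op a b) c],
      [forall a in G, (op e a == a) && (op a e == a)]
    & [forall a in G, exists b in G, (op a b == e) && (op b a == e)]].

Definition quotient_is_group N : bool := is_group (loop_quotient N) set_mul N.

End Normality.

(* The intersection is itself such a subloop, hence the smallest one: see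
   associator_subloop_smallest. *)
Definition associator_subloop (Q : finLoopType) : {set Q} :=
  \bigcap_(N : {set Q} | normal_subloop N && quotient_is_group N) N.

Section AssociatorSubloop.

Variable Q : finLoopType.
Implicit Types (N : {set Q}) (x y z : Q).

Lemma LtrE x y : Ltr x y = x ** y. Proof. by rewrite permE. Qed.
Lemma RtrE x y : Rtr x y = y ** x. Proof. by rewrite permE. Qed.

Lemma subloopP N : reflect
  [/\ lone \in N, forall x y, x \in N -> y \in N -> x ** y \in N,
      forall x z, x \in N -> z \in N -> (Ltr x)^-1 z \in N
    & forall x z, x \in N -> z \in N -> (Rtr x)^-1 z \in N]
  (subloop N).
Proof.
apply: (iffP and4P) => -[n1 nM nL nR]; split=> //.
- by move=> x y Nx Ny; move/forall_inP: nM => /(_ x Nx)/forall_inP; exact.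
- by move=> x y Nx Ny; move/forall_inP: nL => /(_ x Nx)/forall_inP; exact.
- by move=> x y Nx Ny; move/forall_inP: nR => /(_ x Nx)/forall_inP; exact.
- by apply/forall_inP=> x Nx; apply/forall_inP=> y Ny; apply: nM.
- by apply/forall_inP=> x Nx; apply/forall_inP=> y Ny; apply: nL.
- by apply/forall_inP=> x Nx; apply/forall_inP=> y Ny; apply: nR.
Qed.

Lemma normal_subloopP N : reflect
  [/\ subloop N, forall x y, innerL x y @: N = N,
      forall x y, innerR x y @: N = N & forall x, innerT x @: N = N]
  (normal_subloop N).
Proof.
apply: (iffP and4P) => -[s nL nR nT]; split=> //.
- by move=> x y; move/forallP: nL => /(_ x)/forallP/(_ y)/eqP.
- by move=> x y; move/forallP: nR => /(_ x)/forallP/(_ y)/eqP.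
- by move=> x; move/forallP: nT => /(_ x)/eqP.
- by apply/forallP=> x; apply/forallP=> y; apply/eqP.
- by apply/forallP=> x; apply/forallP=> y; apply/eqP.
- by apply/forallP=> x; apply/eqP.
Qed.

Lemma imset_permM (s t : {perm Q}) N : (s * t) @: N = t @: (s @: N).
Proof. by rewrite -imset_comp; apply: eq_imset => x; rewrite permM. Qed.

Lemma imset_permK (s t : {perm Q}) N : (s * t^-1) @: N = N -> s @: N = t @: N.
Proof. by move=> e; rewrite -{2}e -imset_permM mulgKV. Qed.

Section Normal.

Variable N : {set Q}.
Hypothesis nN : normal_subloop N.

Lemma loop_coset_commute x : Rtr x @: N = loop_coset N x.
Proof.
by have [_ _ _ nT] := normal_subloopP _ nN; apply/esym/imset_permK/nT.
Qed.

Lemma Ltr_coset x y : Ltr x @: loop_coset N y = loop_coset N (x ** y).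
Proof.
have [_ nL _ _] := normal_subloopP _ nN.
by rewrite -imset_permM; apply/imset_permK/nL.
Qed.

Lemma Rtr_coset x y : Rtr y @: loop_coset N x = loop_coset N (x ** y).
Proof.
have [_ _ nR _] := normal_subloopP _ nN.
rewrite -!loop_coset_commute -imset_permM.
by apply/imset_permK/nR.
Qed.

Lemma loop_coset_refl x : x \in loop_coset N x.
Proof.
have [/subloopP[n1 _ _ _] _ _ _] := normal_subloopP _ nN.
by apply/imsetP; exists lone; rewrite // LtrE lmulx1.
Qed.

Lemma loop_coset_id n : n \in N -> loop_coset N n = N.
Proof.
have [/subloopP[_ nM nL _] _ _ _] := normal_subloopP _ nN => Nn.
apply/setP=> z; apply/imsetP/idP => [[m Nm ->]|Nz].
  by rewrite LtrE nM.
by exists ((Ltr n)^-1 z); rewrite ?nL ?permKV.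
Qed.

Lemma loop_coset_eq x y : y \in loop_coset N x -> loop_coset N y = loop_coset N x.
Proof.
by case/imsetP=> n Nn ->; rewrite LtrE -Ltr_coset loop_coset_id.
Qed.

Lemma loop_coset_mul x y :
  set_mul (loop_coset N x) (loop_coset N y) = loop_coset N (x ** y).
Proof.
apply/setP=> z; apply/imset2P/idP => [[a b xa yb ->]|].
  rewrite -(loop_coset_eq (x := x ** y) (y := a ** y)).
    by rewrite -Ltr_coset; apply/imsetP; exists b; rewrite ?LtrE.
  by rewrite -Rtr_coset; apply/imsetP; exists a; rewrite ?RtrE.
rewrite -Ltr_coset => /imsetP[b yb ->].
by exists x b; rewrite ?LtrE ?loop_coset_refl.
Qed.

Lemma quotient_is_groupP : reflect
  (forall x y z, x ** (y ** z) \in loop_coset N ((x ** y) ** z))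
  (quotient_is_group N).
Proof.
have [/subloopP[n1 _ _ _] _ _ _] := normal_subloopP _ nN.
have NE : N = loop_coset N lone by rewrite loop_coset_id.
apply: (iffP and5P) => [[_ _ assoc _ _] x y z|assoc].
  have qM u : loop_coset N u \in loop_quotient N by apply: imset_f.
  move/forall_inP: assoc => /(_ _ (qM x))/forall_inP/(_ _ (qM y)).
  move=> /forall_inP/(_ _ (qM z))/eqP.
  by rewrite !loop_coset_mul => <-; apply: loop_coset_refl.
have assocE x y z : loop_coset N (x ** (y ** z)) = loop_coset N ((x ** y) ** z).
  exact/loop_coset_eq/assoc.
split.
- by rewrite [X in X \in _]NE imset_f.
- apply/forall_inP=> _ /imsetP[x _ ->]; apply/forall_inP=> _ /imsetP[y _ ->].
  by rewrite loop_coset_mul imset_f.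
- apply/forall_inP=> _ /imsetP[x _ ->]; apply/forall_inP=> _ /imsetP[y _ ->].
  by apply/forall_inP=> _ /imsetP[z _ ->]; rewrite !loop_coset_mul assocE.
- apply/forall_inP=> _ /imsetP[x _ ->].
  have e1 := loop_coset_mul lone x; have e2 := loop_coset_mul x lone.
  by rewrite -NE ?lmul1x ?lmulx1 in e1 e2; rewrite e1 e2 !eqxx.
- apply/forall_inP=> _ /imsetP[x _ ->].
  have [y [xy _]] := lsolvable x lone; have [y' [yx _]] := rsolvable x lone.
  have e : loop_coset N y' = loop_coset N y.
    by have := assocE y' x y; rewrite xy yx lmulx1 lmul1x.
  apply/exists_inP; exists (loop_coset N y); first exact: imset_f.
  by rewrite -{2}e !loop_coset_mul xy yx -NE eqxx.
Qed.

End Normal.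

Lemma normal_subloop_bigcap (P : pred {set Q}) :
  (forall N, P N -> normal_subloop N) -> normal_subloop (\bigcap_(N | P N) N).
Proof.
move=> nP; set B := \bigcap_(N | P N) N.
have inB z : reflect (forall N, P N -> z \in N) (z \in B) by apply: bigcapP.
have inv (s : {perm Q}) : (forall N, P N -> s @: N = N) -> s @: B = B.
  move=> sP; apply/eqP; rewrite eqEcard card_imset ?leqnn ?andbT; last first.
    exact: perm_inj.
  apply/subsetP=> _ /imsetP[z /inB Bz ->]; apply/inB=> N PN.
  by rewrite -(sP N PN) imset_f ?Bz.
apply/normal_subloopP; split.
- apply/subloopP; split.
  + by apply/inB=> N /nP/normal_subloopP[/subloopP[]].
  + move=> x y /inB Bx /inB By; apply/inB=> N PN.
    have [/subloopP[_ nM _ _] _ _ _] := normal_subloopP _ (nP N PN).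
    by rewrite nM ?Bx ?By.
  + move=> x y /inB Bx /inB By; apply/inB=> N PN.
    have [/subloopP[_ _ nL _] _ _ _] := normal_subloopP _ (nP N PN).
    by rewrite nL ?Bx ?By.
  + move=> x y /inB Bx /inB By; apply/inB=> N PN.
    have [/subloopP[_ _ _ nR] _ _ _] := normal_subloopP _ (nP N PN).
    by rewrite nR ?Bx ?By.
- by move=> x y; apply: inv => N /nP/normal_subloopP[].
- by move=> x y; apply: inv => N /nP/normal_subloopP[].
- by move=> x; apply: inv => N /nP/normal_subloopP[].
Qed.

Lemma associator_subloop_smallest :
  [/\ normal_subloop (associator_subloop Q),
      quotient_is_group (associator_subloop Q)
    & forall N, normal_subloop N -> quotient_is_group N ->
        associator_subloop Q \subset N].
Proof.
have nA : normal_subloop (associator_subloop Q).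
  by apply: normal_subloop_bigcap => N /andP[].
split=> // [|N nN gN]; last by apply: bigcap_inf; rewrite nN gN.
apply/(quotient_is_groupP nA) => x y z.
apply/imsetP; exists ((Ltr ((x ** y) ** z))^-1 (x ** (y ** z))); last by rewrite permKV.
apply/bigcapP=> N /andP[nN /(quotient_is_groupP nN)/(_ x y z)/imsetP[n Nn ->]].
by rewrite permK.
Qed.

End AssociatorSubloop.

Section Products.

Variable Q : finLoopType.

Inductive bracketing : Type :=
  | Factor of Q
  | Product of bracketing & bracketing.

Fixpoint factors (t : bracketing) : seq Q :=
  match t with
  | Factor x => [:: x]
  | Product t1 t2 => factors t1 ++ factors t2
  end.

Fixpoint value (t : bracketing) : Q :=
  match t with
  | Factor x => x
  | Product t1 t2 => value t1 ** value t2
  end.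

Definition products (H : {mset Q}) (q : Q) : Prop :=
  (H = mset0 /\ q = lone) \/
  (exists2 t : bracketing, seq_mset (factors t) = H & value t = q).

Definition products_pow (k : nat) (q : Q) : Prop :=
  exists2 H : {mset Q}, (forall x : Q, H x = k) & products H q.

End Products.

Section MultiplicationTable.

Variable Q : finLoopType.
Implicit Types C : {set Q * Q * Q}.

Definition mul_table : {set Q * Q * Q} := [set (x, y, x ** y) | x : Q, y : Q].

Definition row_of (t : Q * Q * Q) : Q := t.1.1.
Definition col_of (t : Q * Q * Q) : Q := t.1.2.
Definition entry_of (t : Q * Q * Q) : Q := t.2.

Definition occ (f : Q * Q * Q -> Q) C (s : Q) : nat := #|[set t in C | f t == s]|.

Definition regular C : Prop := forall s : Q, occ col_of C s = occ entry_of C s.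

Definition row_mset C : {mset Q} := seq_mset [seq row_of t | t <- enum C].

Definition plex (k : nat) C : Prop :=
  C \subset mul_table /\
  forall s : Q, [/\ occ row_of C s = k, occ col_of C s = k & occ entry_of C s = k].

Definition row_plex (k : nat) C : Prop :=
  C \subset mul_table /\ forall s : Q, occ row_of C s = k.

End MultiplicationTable.

(* Main.v *)
(* View the table as a directed graph in which (x, y, xy) is an edge from y to
   xy labelled x, and fix normal N with Q/N a group.  If an edge set C together
   with one edge from v to u has equal in- and out-degrees everywhere, then the
   labels of C have a product q with qu in vN: peel off an edge (x, u, xu)
   leaving u and let u move to xu; when no edge leaves u, the degree condition
   forces u = v, and the walk restarts at the source of any remaining edge,
   which is harmless because qu in uN means q in N whatever u is. *)
Require Import Defs.
From mathcomp Require Import all_boot all_fingroup.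
From mathcomp Require Import finmap multiset.

Set Implicit Arguments.
Unset Strict Implicit.
Unset Printing Implicit Defensive.

Section RegularProducts.

Variable Q : finLoopType.
Implicit Types (x q u v s : Q) (l : seq (Q * Q * Q)).

(** A bracketing has at least one factor, so the empty product is extended by starting afresh with
    [Factor x]. *)
Lemma products_cons (H : {mset Q}%mset) q x :
  products H q -> products (x +` H)%mset (q ** x).
Proof.
case=> [[-> ->]|[t <- <-]]; right.
  exists (Factor x); last by rewrite lmul1x.
  by apply/msetP=> y; rewrite mset_seqE mset1DE mset0E /= eq_sym.
exists (Product t (Factor x)) => //=.
by rewrite -mset_cons; apply/eq_seq_msetP; rewrite perm_catC.
Qed.

Section GroupQuotient.

Variable N : {set Q}.
Hypotheses (nN : normal_subloop N) (gN : quotient_is_group N).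

Lemma loop_coset_assoc x y z :
  loop_coset N (x ** (y ** z)) = loop_coset N (x ** y ** z).
Proof. exact/(loop_coset_eq nN)/(quotient_is_groupP nN). Qed.

Lemma loop_coset_mulIr u x y :
  loop_coset N (x ** u) = loop_coset N (y ** u) ->
  loop_coset N x = loop_coset N y.
Proof. by rewrite -!(Rtr_coset nN) => /imset_inj; apply; apply: perm_inj. Qed.

(** The terms [(s == v)] and [(s == u)] count the extra edge, with column [v] and entry [u]. *)
Lemma trail_product l u v :
  {in l, forall t, entry_of t = row_of t ** col_of t} ->
  (forall s, count (fun t => col_of t == s) l + (s == v) =
             count (fun t => entry_of t == s) l + (s == u)) ->
  exists2 q, products (seq_mset [seq row_of t | t <- l]) q
           & loop_coset N (q ** u) = loop_coset N v.
Proof.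
(* The induction is on the length, since the edge removed may stand anywhere in [l]. *)
elim: {l}_.+1 {-2}l (ltnSn (size l)) u v => // n IHn l ltln u v tab bal.
have step u1 v1 : has (fun t => col_of t == u1) l ->
    (forall s, count (fun t => col_of t == s) l + (s == v1) =
               count (fun t => entry_of t == s) l + (s == u1)) ->
    exists2 q, products (seq_mset [seq row_of t | t <- l]) q
             & loop_coset N (q ** u1) = loop_coset N v1.
  case/hasP=> t lt /eqP tu bal1; have pl := perm_to_rem lt.
  have [|||q Hq qe] := IHn (rem t l) _ (entry_of t) v1.
  - by move: ltln; rewrite (perm_size pl).
  - by move=> t' /mem_rem; apply: tab.
  (* The column of [t] cancels the term for [u1], and its entry takes over that role. *)
  - move=> s; move: (bal1 s); rewrite !(seq.permP pl) /= tu ![_ == s]eq_sym.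
    by rewrite -addnA [RHS]addnC => /addnI ->; rewrite addnC.
  exists (q ** row_of t).
    have /eq_seq_msetP-> := perm_map (@row_of Q) pl.
    by rewrite mset_cons; apply: products_cons.
  (* Modulo [N] the label of [t] may act on [u1] first, which yields the entry of [t]. *)
  by rewrite -loop_coset_assoc -tu -tab.
case hu: (has (fun t => col_of t == u) l); first exact: step.
have uv : u = v.
  have := bal u; rewrite eqxx addn1; move: hu; rewrite has_count lt0n.
  by move/negbFE/eqP->; case: eqP.
rewrite -{}uv in bal *.
case: l => [|t l] in ltln tab bal step {hu} *.
  exists lone; last by rewrite lmul1x.
  by left; split=> //; apply/msetP=> y; rewrite mset_seqE mset0E.
(* Equal endpoints cancel from the balance, so both can be reset to the column of a remaining
   edge. *)
have [||q Hq qe] := step (col_of t) (col_of t).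
- by rewrite /= eqxx.
- by move=> s; have /addIn-> := bal s.
have qN : loop_coset N q = loop_coset N lone.
  by apply: (@loop_coset_mulIr (col_of t)); rewrite lmul1x.
by exists q => //; rewrite -(Rtr_coset nN) qN (Rtr_coset nN) lmul1x.
Qed.

End GroupQuotient.

Lemma occE (f : Q * Q * Q -> Q) (C : {set Q * Q * Q}) s :
  occ f C s = count (fun t => f t == s) (enum C).
Proof. by rewrite /occ -sum1dep_card -sum1_count big_enum_cond. Qed.

Lemma row_msetE (C : {set Q * Q * Q}) s : row_mset C s = occ (@row_of Q) C s.
Proof. by rewrite mset_seqE count_map occE. Qed.

Lemma regular_products (C : {set Q * Q * Q}) :
  C \subset mul_table Q -> regular C ->
  exists2 q, products (row_mset C) q & q \in associator_subloop Q.
Proof.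
move=> /subsetP tabC regC.
have [nA gA _] := associator_subloop_smallest Q.
have [/subloopP[A1 _ _ _] _ _ _] := normal_subloopP _ nA.
(* With both endpoints [lone], the balance is regularity and the product lies in the coset of
   [lone], the associator subloop. *)
have [||q Hq] := trail_product nA gA (l := enum C) (u := lone) (v := lone).
- by move=> t; rewrite mem_enum => /tabC/imset2P[x y _ _ ->].
- by move=> s; rewrite -!occE regC.
rewrite lmulx1 (loop_coset_id nA A1) => qA.
by exists q => //; have := loop_coset_refl nA q; rewrite qA.
Qed.

End RegularProducts.

Theorem theorem7 (Q : finLoopType) :
  (forall C : {set Q * Q * Q},
     C \subset mul_table Q -> regular C ->
     exists2 q : Q, products (row_mset C) q & q \in associator_subloop Q)
  /\
  (forall k : nat, 1 <= k ->
     (exists C : {set Q * Q * Q}, plex k C) \/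
     (exists2 C : {set Q * Q * Q}, row_plex k C & regular C) ->
     exists2 q : Q, products_pow k q & q \in associator_subloop Q).
Proof.
split=> [|k _ kplex]; first exact: regular_products.
have [C [tabC rowC] regC] : exists2 C : {set Q * Q * Q}, row_plex k C & regular C.
  case: kplex => // -[C [tabC plexC]].
  exists C; first by split=> // s; have [] := plexC s.
  by move=> s; have [_ -> ->] := plexC s.
have [q Hq qA] := regular_products tabC regC.
by exists q => //; exists (row_mset C) => // x; rewrite row_msetE.
Qed.
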